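(* Fix a parameter $\varepsilon\in\left(\omega\left(\frac{\log n}{n}\right),10^{-6}\right)$. Any (randomized) algorithm in the general graph model that, on every $n$-vertex graph $G$, outputs with probability $\ge 1/3$ a clustering $\mathcal{C}'$ with $\mathrm{cost}_G(\mathcal{C}')\le\min_{\mathcal{C}}\mathrm{cost}_G(\mathcal{C})+\varepsilon n^2$ has worst-case query complexity $\Omega(n/\varepsilon)$.
   Context: A clustering is a partition of $V$ ($|V|=n$); $\mathrm{cost}_G(\mathcal{C})$ is the number of non-edges inside parts plus the number of edges between different parts. In the general graph model the algorithm has unit-cost access to: degree queries (given $v$, return $\deg(v)$); neighbor queries (given $v$ and $i$, return the $i$-th neighbor of $v$ if $i\le\deg(v)$, else $\perp$); and pair queries (given $u,v$, return whether $\{u,v\}\in E$). The adjacency list of each vertex is presented in a uniformly random order, independently across vertices. Asymptotic notation is as $n\to\infty$. *)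

(* Defs.v *)
From HB Require Import structures.
From mathcomp Require Import all_boot all_order all_algebra all_fingroup.
From mathcomp Require Import all_classical all_reals all_analysis.

Set Implicit Arguments.
Unset Strict Implicit.
Unset Printing Implicit Defensive.

Import Order.TTheory GRing.Theory Num.Theory.
Import numFieldNormedType.Exports.

Local Open Scope ring_scope.

Record graph (n : nat) := Graph {
  adj :> rel 'I_n;
  adj_sym : symmetric adj;
  adj_irr : irreflexive adj }.

Definition deg (n : nat) (G : graph n) (v : 'I_n) : nat := #|G v|.

Definition clustering (n : nat) (C : {set {set 'I_n}}) : bool :=
  finset.partition C [set: 'I_n]%SET.

Definition together (n : nat) (C : {set {set 'I_n}}) (u v : 'I_n) : bool :=
  [exists B in C, (u \in B) && (v \in B)].

(* An unordered pair {u, v} is counted once, as (u, v) with u < v. *)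
Definition cost (n : nat) (G : graph n) (C : {set {set 'I_n}}) : nat :=
  (#|[set p : 'I_n * 'I_n |
       [&& (p.1 < p.2)%N, together C p.1 p.2 & ~~ G p.1 p.2]]%SET|
   + #|[set p : 'I_n * 'I_n |
       [&& (p.1 < p.2)%N, ~~ together C p.1 p.2 & G p.1 p.2]]%SET|)%N.

Definition singletons (n : nat) : {set {set 'I_n}} :=
  [set [set v] | v : 'I_n]%SET.

Lemma singletons_clustering (n : nat) : clustering (singletons n).
Proof.
apply/and3P; split.
- rewrite finset.eqEsubset finset.subsetT /=; apply/fintype.subsetP => v _.
  by apply/finset.bigcupP; exists [set v]%SET; [exact: finset.imset_f | rewrite inE].
- apply/finset.trivIsetP => _ _ /finset.imsetP[u _ ->] /finset.imsetP[v _ ->] uv.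
  by rewrite disjoints1 inE; apply: contraNneq uv => ->.
- apply/negP => /finset.imsetP[v _ /finset.setP/(_ v)].
  by rewrite !inE eqxx.
Qed.

(* [singletons n] only serves as the default required by [arg min]. *)
Definition opt_cost (n : nat) (G : graph n) : nat :=
  cost G [arg min_(C < singletons n | clustering C) cost G C].

Lemma opt_cost_le (n : nat) (G : graph n) (C : {set {set 'I_n}}) :
  clustering C -> (opt_cost G <= cost G C)%N.
Proof.
rewrite /opt_cost; case: arg_minnP => [|D _]; last exact.
exact: singletons_clustering.
Qed.

Lemma opt_cost_attained (n : nat) (G : graph n) :
  exists2 C : {set {set 'I_n}}, clustering C & cost G C = opt_cost G.
Proof.
rewrite /opt_cost; case: arg_minnP => [|D cD _]; last by exists D.
exact: singletons_clustering.
Qed.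

(* Adjacency lists are indexed from 0: [NeighborQuery v i] asks for the
   (i+1)-st entry of the list of [v]. *)
Variant query (n : nat) :=
  | DegreeQuery of 'I_n
  | NeighborQuery of 'I_n & nat
  | PairQuery of 'I_n & 'I_n.

Definition answer (n : nat) (q : query n) : Type :=
  match q with
  | DegreeQuery _ => nat
  | NeighborQuery _ _ => option 'I_n
  | PairQuery _ _ => bool
  end.

(* An ordering of all adjacency lists: one permutation of the positions of each
   list. The uniform distribution on this product type makes each list uniformly
   random, independently across vertices. *)
Definition ordering (n : nat) (G : graph n) : finType :=
  {dffun forall v : 'I_n, {perm 'I_(deg G v)}}.

Definition neighbor (n : nat) (G : graph n) (s : ordering G) (v : 'I_n)
    (i : nat) : option 'I_n :=
  omap (fun j : 'I_(deg G v) => enum_val (s v j)) (insub i).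

Definition reply (n : nat) (G : graph n) (s : ordering G) (q : query n) :
    answer q :=
  match q return answer q with
  | DegreeQuery v => deg G v
  | NeighborQuery v i => neighbor s v i
  | PairQuery u v => G u v
  end.

(* Deterministic adaptive algorithms. The output need not be a clustering. *)
Inductive dalg (n : nat) :=
  | Output of {set {set 'I_n}}
  | Ask (q : query n) of (answer q -> dalg n).

Fixpoint output (n : nat) (G : graph n) (s : ordering G) (t : dalg n) :
    {set {set 'I_n}} :=
  match t with
  | Output C => C
  | Ask q k => output s (k (reply s q))
  end.

Fixpoint queries (n : nat) (G : graph n) (s : ordering G) (t : dalg n) : nat :=
  match t with
  | Output _ => 0
  | Ask q k => (queries s (k (reply s q))).+1
  end.

(* A randomized algorithm on [n] vertices is a deterministic one selected by
   coins [w] drawn from a probability space, whose output is measurable in [w]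
   on every fixed input. *)
Record ralg (n : nat) (d : measure_display) (Omega : measurableType d) := RAlg {
  run :> Omega -> dalg n;
  measurable_output : forall (G : graph n) (s : ordering G)
      (C : {set {set 'I_n}}),
    measurable [set w : Omega | output s (run w) = C]%classic }.

Definition near_optimal (R : realType) (n : nat) (G : graph n) (eps : R)
    (C : {set {set 'I_n}}) : Prop :=
  clustering C /\ (cost G C)%:R <= (opt_cost G)%:R + eps * n%:R ^+ 2.

(* The coins are independent of the uniformly random ordering. *)
Definition success_probability (R : realType) (n : nat) (d : measure_display)
    (Omega : measurableType d) (P : probability Omega R) (A : ralg n Omega)
    (eps : R) (G : graph n) : \bar R :=
  ((#|ordering G|%:R^-1)%:E *
   \sum_(s : ordering G)
     P [set w : Omega | near_optimal G eps (output s (A w))]%classic)%E.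

(* Worst case over the graph, the ordering and the coins; [+oo] if unbounded. *)
Definition query_complexity (R : realType) (n : nat) (d : measure_display)
    (Omega : measurableType d) (A : ralg n Omega) : \bar R :=
  ereal_sup [set x : \bar R | exists (G : graph n) (s : ordering G) (w : Omega),
    x = (queries s (A w))%:R%:E]%classic.

(* Main.v *)
Require Import Defs.
From mathcomp Require Import all_boot all_order all_algebra all_fingroup.
From mathcomp Require Import zify ring lra.
Set Implicit Arguments.
Unset Strict Implicit.
Unset Printing Implicit Defensive.
Import Order.TTheory GRing.Theory Num.Theory.

(** The hard graphs have a hidden part A, a grid with K = Theta(1/eps) rows and
    S = Theta(eps n) columns, and a clique B' + B'' on all other vertices, where
    B' is a second K x S grid and B'' contains a third one. All of A is joined
    to B' and none of it to B''. Inside A, a random permutation of the rows in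
    each column assigns labels, and the vertices with the same label form a
    clique of size S. Bad triangles A, B', B'' that share no pair show that
    {B' + B''} together with the hidden cliques is optimal, and that any
    near-optimal clustering recovers the hidden clique of most vertices of A.

    Exchange the labels of a random vertex x of A and of a random vertex in its
    column. The adjacency lists are coupled so that every hidden neighbour lost
    or gained trades places with a vertex of B'. When the two executions first
    differ, one of them has just been told "non-edge" or a vertex of B', and for
    such a reply only O(K) of the S K^3 possible exchanges make a difference.
    The exchange being an involution, both executions are covered by this count,
    so q queries notice it with probability O(q / (S K^2)). Otherwise the output
    is unchanged, and it can be right about x for only one of the K labels. *)

(** * Coupling of orderings *)

Section Orderings.
Variable n : nat.

Lemma neighbor_adj (G : graph n) (s : ordering G) (u v : 'I_n) (i : nat) :
  neighbor s u i = Some v -> G u v.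
Proof.
rewrite /neighbor; case: insubP => //= j _ _ [<-].
exact: (enum_valP (s u j)).
Qed.

Lemma ordering_inj (G : graph n) (s s' : ordering G) :
  (forall u i, neighbor s u i = neighbor s' u i) -> s = s'.
Proof.
move=> eq_ss'; apply/ffunP => u; apply/permP => j.
have := eq_ss' u j; rewrite /neighbor valK /= => -[].
exact: enum_val_inj.
Qed.

(** Since [b' u] inverts [b u] on the neighbours of [u], the map [b u] is injective there. Applied
    entry by entry to the list of [u], it therefore yields an ordering of the list of [u] in
    [G']. *)
Lemma transport_ordering (G G' : graph n) (b b' : 'I_n -> 'I_n -> 'I_n)
    (s : ordering G) :
    (forall u v, G u v -> G' u (b u v)) ->
    (forall u v, G u v -> b' u (b u v) = v) ->
    (forall u, deg G u = deg G' u) ->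
  exists s' : ordering G', forall u i,
    neighbor s' u i = omap (b u) (neighbor s u i).
Proof.
move=> Gb bK eq_deg.
have loc u : exists p : {perm 'I_(deg G' u)}, forall j : 'I_(deg G' u),
    enum_val (p j) = b u (enum_val (s u (cast_ord (esym (eq_deg u)) j))).
  (* [enum_rank_in] needs a witness that [u] has a neighbour in [G']; the position [j] provides
     it. *)
  pose f (j : 'I_(deg G' u)) :=
    enum_rank_in (enum_valP j)
      (b u (enum_val (s u (cast_ord (esym (eq_deg u)) j)))).
  have fE j : enum_val (f j) =
      b u (enum_val (s u (cast_ord (esym (eq_deg u)) j))).
    by rewrite /f enum_rankK_in //; apply/Gb/(enum_valP (s u _)).
  have inj_f : injective f.
    move=> i j eq_f.
    have := fE i; rewrite eq_f fE => /(congr1 (b' u)).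
    rewrite !bK; try exact: (enum_valP (s u _)).
    by move/enum_val_inj/perm_inj/cast_ord_inj.
  by exists (perm inj_f) => j; rewrite permE fE.
have [p pE] := fin_all_exists loc.
exists [ffun u => p u] => u i; rewrite /neighbor.
case: (insubP 'I_(deg G' u) i) => [j lt_i vj|le_i].
  rewrite -vj /= ffunE pE.
  have -> : val j = val (cast_ord (esym (eq_deg u)) j) by [].
  by rewrite valK.
by rewrite insubN //= eq_deg.
Qed.

Section Coupling.
Variables (G G' : graph n) (b b' : 'I_n -> 'I_n -> 'I_n).
Hypotheses (Gb : forall u v, G u v -> G' u (b u v))
  (Gb' : forall u v, G' u v -> G u (b' u v))
  (bK : forall u v, G u v -> b' u (b u v) = v)
  (b'K : forall u v, G' u v -> b u (b' u v) = v).

Lemma eq_deg_coupling (u : 'I_n) : deg G u = deg G' u.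
Proof.
apply/eqP; rewrite eqn_leq /deg; apply/andP; split.
  rewrite -(card_in_imset (f := b u) (D := G u)).
    by apply/subset_leq_card/fintype.subsetP => _ /finset.imsetP[v Guv ->]; apply: Gb.
  by move=> v w Guv Guw /(congr1 (b' u)); rewrite !bK.
rewrite -(card_in_imset (f := b' u) (D := G' u)).
  by apply/subset_leq_card/fintype.subsetP => _ /finset.imsetP[v Guv ->]; apply: Gb'.
by move=> v w Guv Guw /(congr1 (b u)); rewrite !b'K.
Qed.

(** Bijectivity makes this a coupling: a uniform ordering of [G] is sent to a uniform ordering of
    [G']. The inverse is the transport along [b']. *)
Lemma ordering_coupling : exists2 h : ordering G -> ordering G',
  bijective h & forall s u i, neighbor (h s) u i = omap (b u) (neighbor s u i).
Proof.
have [h hE] := fin_all_exists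
  (fun s => transport_ordering s Gb bK eq_deg_coupling).
have [h' h'E] := fin_all_exists
  (fun s => transport_ordering s Gb' b'K (fun u => esym (eq_deg_coupling u))).
exists h => //; exists h' => s; apply: ordering_inj => u i.
  rewrite h'E hE; case E: (neighbor s u i) => [v|] //=.
  by rewrite bK // (neighbor_adj E).
rewrite hE h'E; case E: (neighbor s u i) => [v|] //=.
by rewrite b'K // (neighbor_adj E).
Qed.
End Coupling.
End Orderings.

(** * Hard graphs and their queries *)

Section HardGraphs.
Variables (n k s l : nat).
Notation K := k.+1.
Notation S := s.+1.
Notation cell := ('I_K * 'I_S)%type.
(** The first two summands are A and B'; the last two form B''. A cell is a pair (row, column), and
    cells form a finite abelian group under componentwise addition. *)
Notation site := ((cell + cell) + (cell + 'I_l))%type.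
Variables (enc : site -> 'I_n) (dec : 'I_n -> site).
Hypotheses (encK : cancel enc dec) (decK : cancel dec enc).

Notation labelling := {ffun 'I_S -> {perm 'I_K}}.
Implicit Types (phi psi : labelling) (x y : cell) (C : {set {set 'I_n}}).

Definition hidden x : 'I_n := enc (inl (inl x)).

Definition label phi x : 'I_K := phi x.2 x.1.

Definition site_adj phi (a b : site) : bool :=
  match a, b with
  | inl (inl x), inl (inl y) => (x.2 != y.2) && (label phi x == label phi y)
  | inl (inl _), inl (inr _) | inl (inr _), inl (inl _) => true
  | inl (inl _), inr _ | inr _, inl (inl _) => false
  | _, _ => a != b
  end.

Lemma site_adj_sym phi : symmetric (site_adj phi).
Proof.
case=> [[x|x]|x] [[y|y]|y] //=; try by rewrite eq_sym.
by rewrite [_.2 == _]eq_sym [label _ _ == _]eq_sym.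
Qed.

Lemma site_adj_irr phi : irreflexive (site_adj phi).
Proof. by case=> [[x|x]|x] /=; rewrite eqxx. Qed.

Fact hard_sym phi : symmetric (fun u v : 'I_n => site_adj phi (dec u) (dec v)).
Proof. by move=> u v; exact: site_adj_sym. Qed.

Fact hard_irr phi :
  irreflexive (fun u v : 'I_n => site_adj phi (dec u) (dec v)).
Proof. by move=> u; exact: site_adj_irr. Qed.

Definition hard_graph phi : graph n := Graph (hard_sym phi) (hard_irr phi).

Definition partner phi x (c : 'I_S) : cell := ((phi c)^-1%g (label phi x), c).

Lemma label_partner phi x c : label phi (partner phi x c) = label phi x.
Proof. by rewrite {1}/label /= permKV. Qed.

Lemma partnerE phi x y : label phi x = label phi y -> partner phi x y.2 = y.
Proof. by rewrite /partner => ->; rewrite /label permK -surjective_pairing. Qed.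

Lemma eq_partner phi x y : (label phi x == label phi y) = (partner phi x y.2 == y).
Proof.
apply/eqP/eqP => [/partnerE //|<-].
by rewrite label_partner.
Qed.

(* The neighbours of a hidden vertex that change between the two labellings
   are exchanged with row [r] of the second grid, so that a reply that is
   lost or gained is matched with an uninformative one. *)
Definition recouple phi psi (r : 'I_K) (a b : site) : site :=
  match a, b with
  | inl (inl x), inl (inl y) =>
      if label psi x == label psi y then b else inl (inr (r, y.2))
  | inl (inl x), inl (inr y) =>
      if [&& y.1 == r, y.2 != x.2 & partner phi x y.2 != partner psi x y.2]
      then inl (inl (partner psi x y.2)) else b
  | _, _ => b
  end.

Lemma recouple_adj phi psi r a b :
  site_adj phi a b -> site_adj psi a (recouple phi psi r a b).
Proof.
case: a b => [[x|x]|x] [[y|y]|y] //=.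
  by case/andP => xy2 _; case: ifP => //= ->; rewrite xy2.
by case: ifP => //= /and3P[_ xy2 _]; rewrite label_partner eqxx eq_sym xy2.
Qed.

(** A lost hidden neighbour [y] becomes the cell [(r, y.2)] of B', and the reverse map sends this
    cell to [partner phi x y.2], which is [y]. A gained neighbour returns in the same way. *)
Lemma recoupleK phi psi r a b : site_adj phi a b ->
  recouple psi phi r a (recouple phi psi r a b) = b.
Proof.
case: a b => [[x|x]|x] [[y|y]|y] //=.
  case/andP => xy2 /eqP xyphi; case: ifPn => /= [_|]; first by rewrite xyphi eqxx.
  by rewrite eq_partner eqxx [y.2 == x.2]eq_sym xy2 (partnerE xyphi) /= => ->.
case: (boolP [&& _, _ & _]) => [/and3P[/eqP yr xy2 neq]|ny] /=.
  rewrite eq_partner /= (negPf neq).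
  by rewrite -yr -surjective_pairing.
by rewrite [partner psi x _ == _]eq_sym (negPf ny).
Qed.

Definition vrecouple phi psi r (u v : 'I_n) : 'I_n :=
  enc (recouple phi psi r (dec u) (dec v)).

Lemma vrecouple_adj phi psi r u v :
  hard_graph phi u v -> hard_graph psi u (vrecouple phi psi r u v).
Proof. by rewrite /= /vrecouple encK; exact: recouple_adj. Qed.

Lemma vrecoupleK phi psi r u v : hard_graph phi u v ->
  vrecouple psi phi r u (vrecouple phi psi r u v) = v.
Proof. by move=> uv; rewrite /vrecouple encK recoupleK ?decK. Qed.

Lemma deg_hard phi psi u : deg (hard_graph phi) u = deg (hard_graph psi) u.
Proof.
exact: (eq_deg_coupling (@vrecouple_adj phi psi ord0)
  (@vrecouple_adj psi phi ord0) (@vrecoupleK phi psi ord0)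
  (@vrecoupleK psi phi ord0)).
Qed.

(* A query is informative about the pair [phi], [psi] when it is answered
   under [phi] by a non-edge or by a vertex of the second grid, and
   differently under [psi]. *)
Definition informative phi psi (r : 'I_K) (q : query n) : answer q -> bool :=
  match q return answer q -> bool with
  | DegreeQuery _ => fun _ => false
  | NeighborQuery u _ => fun ans =>
      if ans is Some v then
        match dec u, dec v with
        | inl (inl x), inl (inr y) =>
          [&& y.1 == r, y.2 != x.2 & partner phi x y.2 != partner psi x y.2]
        | _, _ => false
        end
      else false
  | PairQuery u v => fun ans => ~~ ans && hard_graph psi u v
  end.

Fixpoint informed phi psi (r : 'I_K) (G : graph n) (o : ordering G)
    (t : dalg n) : bool :=
  match t with
  | Output _ => false
  | Ask q f =>
      informative phi psi r (reply o q) || informed phi psi r o (f (reply o q))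
  end.

(** A coupled reply that changes is a non-edge or a vertex of B' on exactly one side, and it is
    informative on that side. *)
Lemma reply_coupled phi psi r (o : ordering (hard_graph phi))
    (o' : ordering (hard_graph psi)) (q : query n) :
    (forall u i, neighbor o' u i = omap (vrecouple phi psi r u) (neighbor o u i)) ->
    ~~ informative phi psi r (reply o q) ->
    ~~ informative psi phi r (reply o' q) ->
  reply o q = reply o' q.
Proof.
move=> oo'; case: q => [u|u i|u v] /=; first by move=> _ _; exact: deg_hard.
  rewrite oo'; case E: (neighbor o u i) => [v|] //=.
  have uv := neighbor_adj E; have := uv; rewrite /vrecouple /=.
  case Du: (dec u) => [[x|x]|x]; case Dv: (dec v) => [[y|y]|y] //=;
    try by move=> *; congr Some; rewrite -[LHS]decK Dv.
    case: ifPn => [_ _ _ _|]; first by rewrite -Dv decK.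
    (* Here the hidden neighbour [y] is lost, and its image in row [r] is informative under
       [psi]. *)
    rewrite encK eqxx eq_partner /= => neq /andP[xy2 /eqP/partnerE ->] _.
    by rewrite neq [y.2 == x.2]eq_sym xy2.
  by case: ifPn => // _ _ _ _; rewrite -Dv decK.
by case: site_adj; case: site_adj.
Qed.

Lemma output_coupled phi psi r (o : ordering (hard_graph phi))
    (o' : ordering (hard_graph psi)) (t : dalg n) :
    (forall u i, neighbor o' u i = omap (vrecouple phi psi r u) (neighbor o u i)) ->
    ~~ informed phi psi r o t -> ~~ informed psi phi r o' t ->
  output o t = output o' t.
Proof.
move=> oo'; elim: t => //= q f IH; rewrite !negb_or.
case/andP => nq nf /andP[nq' nf'].
have E := reply_coupled oo' nq nq'.
by rewrite -E; apply: IH => //; rewrite E.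
Qed.

(** * Exchanges of labels and the number of informative replies *)

Definition swap x (a : 'I_K) phi : labelling :=
  [ffun c => if c == x.2 then (tperm x.1 a * phi c)%g else phi c].

Lemma swapK x a : involutive (swap x a).
Proof.
move=> phi; apply/ffunP => c; rewrite !ffunE.
by case: (c == x.2) => //; rewrite mulgA tperm2 mul1g.
Qed.

Lemma label_swap x a phi y : label (swap x a phi) y =
  if y.2 == x.2 then label phi (tperm x.1 a y.1, y.2) else label phi y.
Proof. by rewrite /label ffunE; case: ifP => // _; rewrite permM. Qed.

Lemma partner_swap x a phi y c : partner (swap x a phi) y c =
  (if c == x.2 then tperm x.1 a ((phi c)^-1%g (label (swap x a phi) y))
   else (phi c)^-1%g (label (swap x a phi) y), c).
Proof.
rewrite /partner ffunE; case: ifP => // _.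
by rewrite invMg permM tpermV.
Qed.

Lemma tperm_moved (T : finType) (a b z w : T) :
  tperm a b z = w -> w != z -> (a = z /\ b = w) \/ (a = w /\ b = z).
Proof. by case: tpermP => [-> ->|-> ->|_ _ ->]; auto; rewrite eqxx. Qed.

(** A new edge requires exchanging [x] with the vertex [z] of its column labelled like [y], or [y]
    with the vertex [w] of its column labelled like [x]. Two pairs, two orders and K rows [r] give
    the bound. *)
Lemma card_pair_informative phi x y :
  \sum_(t : cell * 'I_K * 'I_K)
    (~~ site_adj phi (inl (inl x)) (inl (inl y)) &&
     site_adj (swap t.1.1 t.1.2 phi) (inl (inl x)) (inl (inl y)))
  <= 4 * K.
Proof.
pose z := partner phi y x.2; pose w := partner phi x y.2.
pose f (t : 'I_K * bool * bool) : cell * 'I_K * 'I_K :=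
  let: (r, b1, b2) := t in
  let: (p, p') := if b1 then (x, z) else (y, w) in
  if b2 then (p, p'.1, r) else (p', p.1, r).
rewrite -big_mkcond /= sum1_card.
apply: leq_trans (leq_trans (leq_imset_card f setT) _); last first.
  by rewrite cardsT !card_prod card_bool card_ord; lia.
apply/subset_leq_card/fintype.subsetP => -[[p a] r]; rewrite unfold_in /=.
case: (eqVneq x.2 y.2) => //= xy2; rewrite !label_swap => /andP[nxy].
have moved (u v : cell) : u.2 = p.2 -> label phi u != label phi v ->
    label phi (tperm p.1 a u.1, u.2) = label phi v ->
    p = u /\ a = (partner phi v u.2).1 \/ p = partner phi v u.2 /\ a = u.1.
  move=> up2 nuv /esym/partnerE /= E.
  have /tperm_moved : tperm p.1 a u.1 = (partner phi v u.2).1 by rewrite E.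
  have neq : (partner phi v u.2).1 != u.1.
    apply: contraNneq nuv => E1; rewrite -(label_partner phi v u.2).
    by rewrite /label E1.
  case/(_ neq) => -[p1 ->]; [left|right]; split=> //.
    by rewrite [p]surjective_pairing p1 -up2 -surjective_pairing.
  by rewrite [p]surjective_pairing p1 -up2.
case: (eqVneq x.2 p.2) => [xp2|xp2]; last first.
  case: (eqVneq y.2 p.2) => [yp2|]; last by rewrite (negPf nxy).
  move=> /eqP/esym; rewrite eq_sym in nxy; case/(moved y x yp2 nxy) => -[-> ->].
    by apply/finset.imsetP; exists (r, false, true); rewrite ?inE.
  by apply/finset.imsetP; exists (r, false, false); rewrite ?inE.
rewrite -xp2 [y.2 == x.2]eq_sym (negPf xy2) => /eqP /(moved x y xp2 nxy) [] [-> ->].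
  by apply/finset.imsetP; exists (r, true, true); rewrite ?inE.
by apply/finset.imsetP; exists (r, true, false); rewrite ?inE.
Qed.

(** The reply fixes the row [r]. The partner of [x] changes only if the exchange moves [x] or its
    old partner [z]; the other exchanged vertex then has K positions. The random row thus makes
    neighbor replies as rarely informative as pair replies. *)
Lemma card_neighbor_informative phi x y :
  \sum_(t : cell * 'I_K * 'I_K)
    [&& y.1 == t.2, y.2 != x.2 &
        partner phi x y.2 != partner (swap t.1.1 t.1.2 phi) x y.2]
  <= 4 * K.
Proof.
pose z := partner phi x y.2.
pose f (t : 'I_K * bool * bool) : cell * 'I_K * 'I_K :=
  let: (j, b1, b2) := t in
  let p := if b1 then x else z in
  if b2 then (p, j, y.1) else ((j, p.2), p.1, y.1).
rewrite -big_mkcond /= sum1_card.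
apply: leq_trans (leq_trans (leq_imset_card f setT) _); last first.
  by rewrite cardsT !card_prod card_bool card_ord; lia.
apply/subset_leq_card/fintype.subsetP => -[[p a] r]; rewrite unfold_in /=.
case/and3P => /eqP <- xy2.
have moved (u : cell) : u.2 = p.2 -> tperm p.1 a u.1 != u.1 ->
    p = u \/ p.2 = u.2 /\ a = u.1.
  move=> up2; case: tpermP; rewrite ?eqxx //.
    by move=> u1; left; rewrite [u]surjective_pairing u1 up2 -surjective_pairing.
  by move=> ->; right.
suff H : (p = x \/ p.2 = x.2 /\ a = x.1) \/ (p = z \/ p.2 = z.2 /\ a = z.1) ->
    (p, a, y.1) \in [set f x0 | x0 in [set: 'I_K * bool * bool]].
  rewrite partner_swap label_swap.
  case: (eqVneq x.2 p.2) => [xp2|xp2].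
    rewrite -xp2 (negPf xy2) => neq; apply/H; left; apply: moved => //.
    apply: contraNneq neq => ->; by rewrite -surjective_pairing.
  case: (eqVneq y.2 p.2) => [yp2|yp2]; last by rewrite eqxx.
  move=> neq; apply/H; right; apply: moved => //=.
  by apply: contraNneq neq => ->.
case=> [[->|[p2 ->]]|[->|[p2 ->]]]; apply/finset.imsetP.
- by exists (a, true, true); rewrite ?inE.
- by exists (p.1, true, false); rewrite ?inE //= -p2 -surjective_pairing.
- by exists (a, false, true); rewrite ?inE.
- by exists (p.1, false, false); rewrite ?inE //= -[y.2]p2 -surjective_pairing.
Qed.

Lemma card_informative phi (o : ordering (hard_graph phi)) (q : query n) :
  \sum_(t : cell * 'I_K * 'I_K)
    informative phi (swap t.1.1 t.1.2 phi) t.2 (reply o q) <= 4 * K.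
Proof.
case: q => [u|u i|u v] /=.
- by rewrite big1.
- case: neighbor => [v|]; last by rewrite big1.
  case: (dec u) => [[x|x]|x]; case: (dec v) => [[y|y]|y]; try by rewrite big1.
  exact: card_neighbor_informative.
- case Du: (dec u) => [[x|x]|x]; case Dv: (dec v) => [[y|y]|y];
    try by rewrite big1 //= => t _; rewrite andNb.
  exact: card_pair_informative.
Qed.

(** The execution on [phi] does not depend on the exchange [e], so the bound for a single reply adds
    up along it. *)
Lemma card_informed phi (o : ordering (hard_graph phi)) (t : dalg n) :
  \sum_(e : cell * 'I_K * 'I_K) informed phi (swap e.1.1 e.1.2 phi) e.2 o t
  <= queries o t * (4 * K).
Proof.
elim: t => [C|q f IH] /=; first by rewrite big1.
rewrite mulSn; apply: leq_trans (leq_add (card_informative o q) (IH _)).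
by rewrite -big_split /=; apply: leq_sum => e _; case: informative; case: informed.
Qed.

End HardGraphs.

(** * Costs *)

Section Clusterings.
Variable n : nat.
Implicit Types (G : graph n) (C : {set {set 'I_n}}).

Lemma together_sym C : symmetric (together C).
Proof.
by move=> u v; apply/exists_inP/exists_inP => -[B CB /andP[uB vB]];
  exists B; rewrite ?uB ?vB.
Qed.

Lemma together_trans C : clustering C -> transitive (together C).
Proof.
case/and3P => _ tI _ v u w /exists_inP[B CB /andP[uB vB]].
case/exists_inP => D CD /andP[vD wD]; apply/exists_inP; exists B => //.
rewrite uB /=; suff -> : B = D by [].
by rewrite -(def_pblock tI CB vB) (def_pblock tI CD vD).
Qed.

Definition violated G C (u v : 'I_n) : bool :=
  (u != v) && (together C u v != G u v).

Lemma violated_sym G C : symmetric (violated G C).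
Proof. by move=> u v; rewrite /violated eq_sym together_sym adj_sym. Qed.

Lemma cost_violated G C : 2 * cost G C = \sum_u \sum_v violated G C u v.
Proof.
have costE : cost G C =
    \sum_(p : 'I_n * 'I_n) ((p.1 < p.2) && violated G C p.1 p.2).
  rewrite /cost -!sum1_card !(big_mkcond (fun p => p \in _)) -big_split /=.
  apply: eq_bigr => -[u v] _; rewrite !inE /= /violated -(inj_eq val_inj) /=.
  by case: ltngtP; case: together; case: (G u v).
rewrite pair_big /= mul2n -addnn {2}costE.
rewrite (reindex_inj (h := fun p => (p.2, p.1))) /=; last first.
  by move=> [u v] [u' v'] /= [-> ->].
rewrite costE -big_split /=; apply: eq_bigr => -[u v] _ /=.
rewrite [violated G C v u]violated_sym /violated -(inj_eq val_inj) /=.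
by case: ltngtP; case: together; case: (G u v).
Qed.

(** Respecting both edges puts [u] and [w] together by transitivity, which violates the non-edge. *)
Lemma bad_triangle G C u v w : clustering C -> u != v -> u != w -> v != w ->
  G u v -> G v w -> ~~ G u w ->
  0 < violated G C u v + violated G C u w + violated G C v w.
Proof.
move=> cC uv uw vw Guv Gvw nGuw; rewrite /violated uv uw vw Guv Gvw (negPf nGuw).
case tuv: (together C u v); case tvw: (together C v w) => //.
  by rewrite (together_trans cC tuv tvw).
all: by case: together.
Qed.

Lemma preim_clustering (T : eqType) (key : 'I_n -> T) :
  clustering (preim_partition key [set: 'I_n]).
Proof. exact: preim_partitionP. Qed.

Lemma together_preim (T : eqType) (key : 'I_n -> T) u v :
  together (preim_partition key [set: 'I_n]) u v = (key u == key v).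
Proof.
have eqv : {in [set: 'I_n] & &, equivalence_rel [rel x y | key x == key y]}.
  by split=> //= /eqP ->.
have [/eqP cov tI _] := and3P (preim_clustering key).
rewrite -[RHS](pblock_equivalence_partition eqv) ?inE //.
apply/exists_inP/idP => [[B CB /andP[uB vB]]|vP].
  by rewrite (def_pblock tI CB uB).
exists (pblock (preim_partition key [set: 'I_n]) u).
  by apply: pblock_mem; rewrite cov inE.
by rewrite vP mem_pblock cov inE.
Qed.
End Clusterings.

(** * Optimal cost of the hard graphs and recovery of the hidden cliques *)

Section HardCosts.
Variables (n k s l : nat).
Notation K := k.+1.
Notation S := s.+1.
Notation cell := ('I_K * 'I_S)%type.
Notation site := ((cell + cell) + (cell + 'I_l))%type.
Variables (enc : site -> 'I_n) (dec : 'I_n -> site).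
Hypotheses (encK : cancel enc dec) (decK : cancel dec enc).

Notation labelling := {ffun 'I_S -> {perm 'I_K}}.
Implicit Types (phi psi : labelling) (x y : cell) (C : {set {set 'I_n}}).
Notation hard_graph := (hard_graph dec).
Notation hidden := (hidden enc).

Definition errors C phi x : nat :=
  \sum_y violated (hard_graph phi) C (hidden x) (hidden y).

Definition recovered C phi x : bool := 4 * errors C phi x < S.

Lemma sum_site (F : site -> nat) : \sum_a F a =
  \sum_x F (inl (inl x)) + \sum_x F (inl (inr x)) + \sum_z F (inr z).
Proof. by rewrite !big_sumType. Qed.

(** Any two of the cells [x], [y], [x + y] determine the third, so the bad triangles share no pair.
    They also use no pair inside A, so the errors there come on top. *)
Lemma cost_hard_lower phi C : clustering C ->
  \sum_x errors C phi x + 2 * (K * S) ^ 2 <= 2 * cost (hard_graph phi) C.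
Proof.
move=> cC; rewrite cost_violated.
set vio := violated _ _.
have bij_enc : bijective enc by exists dec.
pose h x := enc (inl (inl x)).
pose g x := enc (inl (inr x)).
pose f x := enc (inr (inl x)).
rewrite (reindex enc) /=; last exact: onW_bij.
under [X in _ <= X]eq_bigr => a _.
  rewrite (reindex enc) /=; last exact: onW_bij.
  over.
have tri x y : 0 < vio (h x) (g y) + vio (h x) (f (x + y)%R) + vio (g y) (f (x + y)%R).
  by apply: bad_triangle; rewrite //= ?(can_eq encK) ?encK.
(* The triangles on [h x], [g y], [f (x + y)] pairwise share no pair. *)
have packing : (K * S) ^ 2 <=
    \sum_x \sum_y vio (h x) (g y) + \sum_x \sum_y vio (h x) (f y)
    + \sum_x \sum_y vio (g x) (f y).
  have -> : \sum_x \sum_y vio (h x) (f y) =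
      \sum_(x : cell) \sum_(y : cell) vio (h x) (f (x + y)%R).
    by apply: eq_bigr => x _; rewrite (reindex_inj (addrI x)).
  have -> : \sum_x \sum_y vio (g x) (f y) =
      \sum_(x : cell) \sum_(y : cell) vio (g y) (f (x + y)%R).
    rewrite [RHS]exchange_big /=; apply: eq_bigr => y _.
    by rewrite (reindex_inj (addIr y)).
  rewrite -!big_split /=.
  have -> : (K * S) ^ 2 = \sum_(x : cell) \sum_(y : cell) 1.
    by rewrite !sum_nat_const !card_prod !card_ord; lia.
  by apply: leq_sum => x _; rewrite -!big_split /=; apply: leq_sum => y _.
rewrite sum_site /=.
under [X in _ <= X + _ + _]eq_bigr => x _ do rewrite sum_site big_sumType /=.
under [X in _ <= _ + X + _]eq_bigr => x _ do rewrite sum_site big_sumType /=.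
rewrite big_sumType /=.
under [X in _ <= _ + _ + (X + _)]eq_bigr => x _ do rewrite sum_site big_sumType /=.
rewrite !big_split /=.
have symm (F F' : cell -> 'I_n) :
    \sum_x \sum_y vio (F x) (F' y) = \sum_x \sum_y vio (F' x) (F y).
  rewrite exchange_big /=; apply: eq_bigr => x _; apply: eq_bigr => y _.
  by rewrite /vio violated_sym.
(* Each mixed block occurs in both orders, whence the factor 2; [e1] to [e6] are dropped. *)
have arith (N hh hg hf gh gf fh fg e1 e2 e3 e4 e5 e6 : nat) :
    N <= hg + hf + gf -> hg = gh -> hf = fh -> gf = fg ->
    hh + 2 * N <= hh + hg + (hf + e1) + (gh + e2 + (gf + e3))
      + (fh + fg + (e4 + e5) + e6) by lia.
exact: (arith _ _ _ _ _ _ _ _ _ _ _ _ _ _ packing (symm h g) (symm h f)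
  (symm g f)).
Qed.

(** The hidden cliques together with the clique B' + B'' cut only the edges between A and B'. *)
Lemma opt_cost_hard_upper phi : opt_cost (hard_graph phi) <= (K * S) ^ 2.
Proof.
pose key u := if dec u is inl (inl x) then Some (label phi x) else None.
apply: leq_trans (opt_cost_le _ (preim_clustering key)) _.
pose f (p : cell * cell) :=
  let: (u, v) := (enc (inl (inl p.1)), enc (inl (inr p.2))) in
  if u < v then (u, v) else (v, u).
rewrite /cost (_ : [set p | _] = set0) ?finset.cards0 ?add0n; last first.
  apply/setP => -[u v]; rewrite !inE /= together_preim /key.
  apply/negP => /and3P[uv eq_uv /negP[]].
  have nuv : dec u != dec v.
    by rewrite (can_eq decK) -(inj_eq val_inj) /= neq_ltn uv.
  move: eq_uv nuv; case: (dec u) => [[x|x]|x]; case: (dec v) => [[y|y]|y] //=.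
  move=> /eqP[lxy] nxy; rewrite lxy eqxx andbT; apply: contraNneq nxy => xy2.
  apply/eqP; congr (inl (inl _)); move: lxy.
  rewrite [x]surjective_pairing [y]surjective_pairing /label /= xy2.
  by move/perm_inj => ->.
apply: leq_trans (leq_trans (leq_imset_card f setT) _); last first.
  by rewrite cardsT !card_prod !card_ord; lia.
apply/subset_leq_card/fintype.subsetP => -[u v]; rewrite inE /= together_preim.
case/and3P=> uv; rewrite /key.
case Du: (dec u) => [[x|x]|x]; case Dv: (dec v) => [[y|y]|y] //=.
- by move=> nl /andP[_ /eqP E]; rewrite E eqxx in nl.
- move=> _ _; apply/finset.imsetP; exists (x, y); rewrite ?inE //= /f /=.
  by rewrite -Du -Dv !decK uv.
- move=> _ _; apply/finset.imsetP; exists (y, x); rewrite ?inE //= /f /=.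
  by rewrite -Du -Dv !decK ltnNge (ltnW uv).
Qed.

(** Markov's inequality: a vertex that is not recovered has at least S/4 errors. *)
Lemma recovered_lower C phi :
  K * S * S <= (\sum_x recovered C phi x) * S + 4 * \sum_x errors C phi x.
Proof.
rewrite big_distrl big_distrr /= -big_split /=.
have -> : K * S * S = \sum_(x : cell) S.
  by rewrite sum_nat_const card_prod !card_ord.
apply: leq_sum => x _; rewrite /recovered.
by case: (leqP S (4 * errors C phi x)) => //= _; rewrite mul1n leq_addr.
Qed.

(** As [a] varies, [x] receives every label, and its hidden neighbourhoods [N a] are disjoint sets
    of size [s]. Two recoveries with at most [s / 4] errors each cannot account for the [s] vertices
    of one of them. *)
Lemma recovered_unique C phi x : 0 < s ->
  \sum_a recovered C (swap x a phi) x <= 1.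
Proof.
move=> s_gt0; rewrite -big_mkcond /= sum1_card.
apply/card_le1_eqP => a b; rewrite !unfold_in => ra rb.
apply/eqP; apply: contraTT isT => ab.
pose N a' := [set y : cell | (y.2 != x.2) && (label phi y == phi x.2 a')].
have adjN a' y : hard_graph (swap x a' phi) (hidden x) (hidden y) = (y \in N a').
  rewrite /= !encK /= inE eq_sym !label_swap eqxx.
  by case: eqVneq => //= _; rewrite /label /= tpermL eq_sym.
have cardN : s <= #|N b|.
  have inj : {in [set c | c != x.2] &,
      injective (fun c : 'I_S => ((phi c)^-1%g (phi x.2 b), c))}.
    by move=> c c' _ _ [].
  have cardc : #|[set c : 'I_S | c != x.2]| = s.
    have -> : [set c : 'I_S | c != x.2] = [set~ x.2].
      by apply/setP => c; rewrite !inE.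
    by rewrite cardsC1 card_ord.
  rewrite -[X in X <= _]cardc -(card_in_imset inj); apply/subset_leq_card.
  apply/fintype.subsetP => y /finset.imsetP[c]; rewrite inE => cx ->.
  by rewrite inE /= cx /label /= permKV.
(* A vertex of [N b] is adjacent to [x] after one exchange and not after the other, so [C] errs on
   it at least once. *)
have : #|N b| <= errors C (swap x a phi) x + errors C (swap x b phi) x.
  rewrite -sum1_card big_mkcond /= -big_split /=; apply: leq_sum => y _.
  case: ifP => // yN; rewrite /violated !adjN yN.
  have -> : (y \in N a) = false.
    apply: contraNF ab; rewrite !inE; move: yN; rewrite inE.
    by move=> /andP[_ /eqP ->] /andP[_ /eqP/perm_inj ->].
  rewrite (can_eq encK).
  have -> : inl (inl x) != inl (inl y) :> site.
    by move: yN; rewrite inE => /andP[+ _]; apply: contraNneq => -[->].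
  by case: together.
by move: ra rb cardN; rewrite /recovered; lia.
Qed.
End HardCosts.

(** * Recovery of the hidden labels *)

Section Recovery.
Variables (n k s l : nat).
Notation K := k.+1.
Notation S := s.+1.
Notation cell := ('I_K * 'I_S)%type.
Notation site := ((cell + cell) + (cell + 'I_l))%type.
Variables (enc : site -> 'I_n) (dec : 'I_n -> site).
Hypotheses (encK : cancel enc dec) (decK : cancel dec enc).

Notation labelling := {ffun 'I_S -> {perm 'I_K}}.
Implicit Types (phi psi : labelling) (x y : cell) (t : dalg n).
Notation hard_graph := (hard_graph dec).
Notation orders phi := (ordering (hard_graph phi)).
Notation recovered := (recovered enc dec).
Notation informed := (informed dec).

Lemma hard_coupling phi psi r : exists2 h : orders phi -> orders psi,
  bijective h & forall o u i,
    neighbor (h o) u i = omap (vrecouple enc dec phi psi r u) (neighbor o u i).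
Proof.
exact: (ordering_coupling (vrecouple_adj encK psi r) (vrecouple_adj encK phi r)
  (vrecoupleK encK decK psi r) (vrecoupleK encK decK phi r)).
Qed.

Lemma card_hard_ordering phi psi : #|orders phi| = #|orders psi|.
Proof. by have [h /bij_eq_card] := hard_coupling phi psi ord0. Qed.

Lemma recovered_coupled phi psi r x t :
  \sum_(o : orders psi) recovered (output o t) psi x <=
  \sum_(o : orders phi) recovered (output o t) psi x
  + \sum_(o : orders phi) informed phi psi r o t
  + \sum_(o : orders psi) informed psi phi r o t.
Proof.
have [h bij_h hE] := hard_coupling phi psi r.
rewrite (reindex h) /=; last exact: onW_bij.
rewrite [X in _ <= _ + X](reindex h) /=; last exact: onW_bij.
rewrite -!big_split /=; apply: leq_sum => o _.
have := output_coupled (t := t) encK decK (hE o).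
case: informed => /=; first by move=> _; case: recovered; lia.
case: informed => /=; first by move=> _; case: recovered; lia.
by move=> -> //; lia.
Qed.

(** The factor [K * K] counts the choices of [a] and [r]. The output before the exchange does not
    depend on [a], so by [recovered_unique] it fits one value of [a] for each [x] and [r]. The rest
    is charged to informed executions. *)
Lemma sum_recovered (q : nat) t : 0 < s ->
    (forall phi (o : orders phi), queries o t <= q) ->
  K * K * \sum_phi \sum_(o : orders phi) \sum_x recovered (output o t) phi x <=
  (K * S * K + 2 * (q * (4 * K))) * \sum_phi \sum_(o : orders phi) 1.
Proof.
move=> s_gt0 qmax; pose edit := (cell * 'I_K * 'I_K)%type.
pose F (e : edit) phi := swap e.1.1 e.1.2 phi.
have FK e : involutive (F e) by exact: swapK.
have -> : K * K * \sum_phi \sum_(o : orders phi) \sum_x recovered (output o t) phi x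
    = \sum_(e : edit) \sum_phi \sum_(o : orders phi)
        recovered (output o t) phi e.1.1.
  rewrite [RHS]exchange_big [LHS]big_distrr; apply: eq_bigr => phi _ /=.
  rewrite [RHS]exchange_big [LHS]big_distrr; apply: eq_bigr => o _ /=.
  rewrite -(pair_bigA_idem _ (fun p r => recovered (output o t) phi p.1 : nat)) //=.
  rewrite -(pair_bigA_idem _ (fun x a =>
    \sum_(r < K) (recovered (output o t) phi x : nat))) //= big_distrr /=.
  by apply: eq_bigr => x _; rewrite !sum_nat_const !card_ord mulnA.
have step (e : edit) :
    \sum_phi \sum_(o : orders phi) recovered (output o t) phi e.1.1 <=
    \sum_phi \sum_(o : orders phi) recovered (output o t) (F e phi) e.1.1
    + 2 * \sum_phi \sum_(o : orders phi) informed phi (F e phi) e.2 o t.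
  rewrite mul2n -addnn addnA.
  (* The exchange is an involution, so the informed executions on both sides have equal sums; this
     is the factor 2. *)
  rewrite (reindex_inj (inv_inj (FK e))) /=.
  rewrite [X in _ <= _ + X](reindex_inj (inv_inj (FK e))) /=.
  rewrite -!big_split /=; apply: leq_sum => phi _.
  by rewrite FK; exact: recovered_coupled.
apply: leq_trans; first by apply: leq_sum => e _; exact: step.
rewrite big_split /= -big_distrr /= mulnDl; apply: leq_add.
  rewrite [leqLHS]exchange_big [leqRHS]big_distrr; apply: leq_sum => phi _ /=.
  rewrite [leqLHS]exchange_big [leqRHS]big_distrr; apply: leq_sum => o _ /=.
  rewrite -(pair_bigA_idem _ (fun p r =>
    recovered (output o t) (swap p.1 p.2 phi) p.1 : nat)) //=.
  rewrite exchange_big /=.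
  have -> : K * S * K * 1 = \sum_(r < K) \sum_(x : cell) 1.
    by rewrite !sum_nat_const card_prod !card_ord; lia.
  apply: leq_sum => r _.
  rewrite -(pair_bigA_idem _ (fun x a =>
    recovered (output o t) (swap x a phi) x : nat)) //=.
  by apply: leq_sum => x _; exact: recovered_unique.
rewrite -mulnA leq_mul2l /=.
rewrite [leqLHS]exchange_big [leqRHS]big_distrr; apply: leq_sum => phi _ /=.
rewrite [leqLHS]exchange_big [leqRHS]big_distrr; apply: leq_sum => o _ /=.
apply: leq_trans (card_informed o t) _.
by rewrite muln1 leq_mul2r qmax orbT.
Qed.
End Recovery.

From mathcomp Require Import all_classical all_reals all_analysis.
From mathcomp Require Import measurable_realfun.
Import numFieldNormedType.Exports.
Local Open Scope ring_scope.

(** * Success probability *)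

(** Linearity of expectation: a bound valid for every outcome of the coins passes to the average, as
    in Yao's principle. *)
Lemma sum_probability_le (R : realType) (d : measure_display)
    (Omega : measurableType d) (P : probability Omega R) (I : finType)
    (E : I -> set Omega) (B : R) :
    (forall i, measurable (E i)) ->
    (forall w, \sum_i \1_(E i) w <= B) ->
  (\sum_i P (E i) <= B%:E)%E.
Proof.
move=> mE leB.
have -> : (\sum_i P (E i) = \int[P]_w \sum_i (\1_(E i) w)%:E)%E.
  rewrite ge0_integral_sum //.
  - by apply: eq_bigr => i _; rewrite integral_indic // setIT.
  - by move=> i; apply/measurable_EFinP; exact: measurable_indic.
apply: (@le_trans _ _ (\int[P]_w (cst B%:E) w)%E); last first.
  by rewrite integral_cst //= [P _]probability_setT mule1.
apply: ge0_le_integral => //.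
- by move=> w _; apply: sume_ge0 => i _; rewrite lee_fin.
- by apply: emeasurable_sum => i; apply/measurable_EFinP; exact: measurable_indic.
- by move=> w _; rewrite sumEFin lee_fin; exact: leB.
Qed.

Section Success.
Variables (R : realType) (n k s l : nat).
Notation K := k.+1.
Notation S := s.+1.
Notation cell := ('I_K * 'I_S)%type.
Notation site := ((cell + cell) + (cell + 'I_l))%type.
Variables (enc : site -> 'I_n) (dec : 'I_n -> site).
Hypotheses (encK : cancel enc dec) (decK : cancel dec enc).
Variables (eps : R) (q : nat).
Hypotheses (s_gt0 : (0 < s)%N)
  (eps_small : 16 * (eps * n%:R ^+ 2) <= (K * S * S)%:R)
  (q_small : (6 * (K * S + 8 * q) < K * K * S)%N).

Notation labelling := {ffun 'I_S -> {perm 'I_K}}.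
Notation hard_graph := (hard_graph dec).
Notation orders phi := (ordering (hard_graph phi)).

(** The two cost bounds meet at [(K * S) ^ 2], which leaves at most [2 * eps * n ^ 2], hence K S^2 /
    8, errors in total. At most half of the vertices can then have S/4 of them. *)
Lemma near_optimal_recovered (phi : labelling) (C : {set {set 'I_n}}) :
  near_optimal (hard_graph phi) eps C ->
  (K * S <= 2 * \sum_x recovered enc dec C phi x)%N.
Proof.
case=> cC le_cost.
have lower := cost_hard_lower encK decK phi cC.
have upper := opt_cost_hard_upper decK phi.
have err : (\sum_x errors enc dec C phi x)%:R <= 2 * (eps * n%:R ^+ 2).
  move: lower upper; rewrite -!(ler_nat R) natrD ![(2 * _)%:R]natrM; lra.
have rec := recovered_lower enc dec C phi.
have : (K * S * S <= 2 * ((\sum_x recovered enc dec C phi x) * S))%N.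
  rewrite -(ler_nat R); move: rec; rewrite -(ler_nat R).
  move: err eps_small; rewrite natrD 2!natrM [(2 * _)%:R]natrM; lra.
by rewrite mulnA leq_pmul2r.
Qed.

(** A success recovers at least K S / 2 vertices, whereas [sum_recovered] bounds the average number
    by S + 8 q / K. *)
Lemma deterministic_success (t : dalg n) :
    (forall (phi : labelling) (o : orders phi), (queries o t <= q)%N) ->
  (3 * \sum_(phi : labelling) \sum_(o : orders phi)
     `[< near_optimal (hard_graph phi) eps (output o t) >] <
   \sum_(phi : labelling) \sum_(o : orders phi) 1)%N.
Proof.
move=> qmax; have := sum_recovered encK decK s_gt0 qmax.
set succ := (\sum_phi \sum_o `[< _ >])%N.
set tot := (\sum_phi \sum_o 1)%N; set rec := (\sum_phi \sum_o \sum_x _)%N.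
have tot_gt0 : (0 < tot)%N.
  rewrite /tot (bigD1 [ffun=> 1%g]) //= addn_gt0 sum1_card; apply/orP; left.
  by apply/card_gt0P; exists [ffun=> 1%g].
have succ_rec : (K * S * succ <= 2 * rec)%N.
  rewrite /succ /rec !big_distrr /=; apply: leq_sum => phi _.
  rewrite !big_distrr /=; apply: leq_sum => o _.
  case: asboolP => [/near_optimal_recovered|_]; first by rewrite muln1.
  by rewrite muln0.
move=> main.
have le1 : (K * K * S * (3 * succ) <= 6 * (K * S + 8 * q) * tot)%N.
  have : (K * (K * K * S * (3 * succ)) <= K * (6 * (K * S + 8 * q) * tot))%N.
    by move: (leq_mul (leqnn (3 * (K * K))) succ_rec) (leq_mul (leqnn 6) main); nia.
  by rewrite leq_pmul2l.
have lt2 : (6 * (K * S + 8 * q) * tot < K * K * S * tot)%N.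
  by rewrite ltn_pmul2r.
by have := leq_ltn_trans le1 lt2; rewrite ltn_pmul2l // !muln_gt0.
Qed.

Lemma measurable_near_optimal (d : measure_display) (Omega : measurableType d)
    (A : ralg n Omega) (G : graph n) (o : ordering G) :
  measurable [set w : Omega | near_optimal G eps (output o (A w))]%classic.
Proof.
have -> : [set w : Omega | near_optimal G eps (output o (A w))]%classic =
    (\bigcup_(C in [set C | near_optimal G eps C])
      [set w | output o (A w) = C])%classic.
  apply/seteqP; split => [w ow|w [C /= oC eqC]]; last by rewrite /= eqC.
  by exists (output o (A w)).
apply: fin_bigcup_measurable => [|C _]; last exact: measurable_output.
exact: finite_finset.
Qed.

Lemma randomized_failure (d : measure_display) (Omega : measurableType d)
    (P : probability Omega R) (A : ralg n Omega) :
    (forall (G : graph n) (o : ordering G) w, (queries o (A w) <= q)%N) ->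
  exists G : graph n, (success_probability P A eps G < (3^-1)%:E)%E.
Proof.
move=> qmax; apply/not_existsP => fail.
(* All hard graphs have equally many orderings, so a uniform pair [(phi, o)] averages the success
   probabilities uniformly over [phi]. *)
pose W := #|orders ([ffun=> 1%g] : labelling)|.
have WE phi : #|orders phi| = W by exact: card_hard_ordering encK decK _ _.
pose I : finType := {phi : labelling & orders phi}%type.
pose E (p : I) : set Omega :=
  [set w | near_optimal (hard_graph (tag p)) eps (output (tagged p) (A w))]%classic.
have W_gt0 : (0 < W)%N by apply/card_gt0P; exists [ffun=> 1%g].
have cardI : #|I| = (#|{: labelling}| * W)%N.
  rewrite card_tagged sumnE big_map big_enum /=.
  under eq_bigr => phi _ do rewrite WE.
  by rewrite sum_nat_const.
have lower : ((#|I|%:R / 3)%:E <= \sum_(p : I) P (E p))%E.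
  rewrite -(sig_big_dep xpredT (fun _ => xpredT)
    (fun phi o => P (E (Tagged (fun phi => orders phi) o)))) /=.
  have -> : ((#|I|%:R / 3)%:E = \sum_(phi : labelling) (W%:R / 3)%:E :> \bar R)%E.
    by rewrite sumEFin sumr_const cardI natrM -mulrA mulr_natl.
  apply: lee_sum => phi _.
  have /negP := fail (hard_graph phi); rewrite -leNgt /success_probability WE.
  by rewrite lee_pdivlMl ?ltr0n // -EFinM.
(* The strict bound on integers is sharpened to [#|I|.-1], since only a weak inequality survives
   integration. *)
have upper : (\sum_(p : I) P (E p) <= ((#|I|.-1)%:R / 3)%:E)%E.
  apply: sum_probability_le => [p|w]; first exact: measurable_near_optimal.
  have := deterministic_success (fun phi (o : orders phi) => qmax _ o w).
  rewrite (sig_big_dep xpredT (fun _ => xpredT) (fun _ _ => 1%N)) /= sum1_card.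
  rewrite (sig_big_dep xpredT (fun _ => xpredT)
    (fun phi o => `[< near_optimal (hard_graph phi) eps (output o (A w)) >] : nat)) /=.
  have -> : \sum_(p : I) \1_(E p) w = (\sum_(p : I)
      `[< near_optimal (hard_graph (tag p)) eps (output (tagged p) (A w)) >])%:R :> R.
    by rewrite natr_sum; apply: eq_bigr => p _; rewrite indicE.
  move: (\sum_(p : I) _)%N => m lt_m.
  rewrite ler_pdivlMr ?ltr0n // -natrM ler_nat mulnC -ltnS.
  by rewrite (leq_trans lt_m) // leqSpred.
have := le_trans lower upper; rewrite lee_fin ler_pM2r ?invr_gt0 ?ltr0n // ler_nat.
have : (0 < #|I|)%N.
  by rewrite cardI muln_gt0 W_gt0 andbT; apply/card_gt0P; exists [ffun=> 1%g].
by case: #|I| => // m _; rewrite /= ltnn.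
Qed.
End Success.

(** * Choice of the parameters and the asymptotic bound *)

Lemma ord_coding (T : finType) (n : nat) : #|T| = n ->
  exists (enc : T -> 'I_n) (dec : 'I_n -> T), cancel enc dec /\ cancel dec enc.
Proof.
move=> <-; exists enum_rank, enum_val; split; [exact: enum_rankK|exact: enum_valK].
Qed.

Lemma few_queries_failure (R : realType) (n k s q : nat) (eps : R)
    (d : measure_display) (Omega : measurableType d) (P : probability Omega R)
    (A : ralg n Omega) :
    (0 < s)%N -> (3 * (k.+1 * s.+1) <= n)%N ->
    16 * (eps * n%:R ^+ 2) <= (k.+1 * s.+1 * s.+1)%:R ->
    (6 * (k.+1 * s.+1 + 8 * q) < k.+1 * k.+1 * s.+1)%N ->
    (forall (G : graph n) (o : ordering G) w, (queries o (A w) <= q)%N) ->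
  exists G : graph n, (success_probability P A eps G < (3^-1)%:E)%E.
Proof.
move=> s_gt0 le_n small_eps small_q qmax.
(* The vertices outside the three grids are added to B''. *)
have [|enc [dec [encK decK]]] := @ord_coding
  (('I_k.+1 * 'I_s.+1 + 'I_k.+1 * 'I_s.+1)
   + ('I_k.+1 * 'I_s.+1 + 'I_(n - 3 * (k.+1 * s.+1))))%type n.
  by rewrite !card_sum !card_prod !card_ord; lia.
exact: (randomized_failure encK decK s_gt0 small_eps small_q P qmax).
Qed.

(* [s.+1] is about [100 * eps * n] and [k.+1] about [n / (3 * s.+1)]. *)
Lemma hard_parameters (R : realType) (n : nat) (eps : R) :
    0 < eps < 10 ^- 6 -> 1 <= eps * n%:R ->
  exists k s, [/\ (0 < s)%N, (3 * (k.+1 * s.+1) <= n)%N,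
    16 * (eps * n%:R ^+ 2) <= (k.+1 * s.+1 * s.+1)%:R &
    forall q : nat, q%:R <= 10 ^- 5 * (n%:R / eps) ->
      (6 * (k.+1 * s.+1 + 8 * q) < k.+1 * k.+1 * s.+1)%N].
Proof.
move=> /andP[eps_gt0 eps_lt] x_ge1.
have eps_lt' : 100 * (100 * (100 * eps)) < 1.
  have E : 10 ^+ 6 * eps < 1.
    by rewrite -[ltRHS](mulfV (x := 10 ^+ 6 : R)) ?expf_neq0 // ltr_pM2l ?exprn_gt0.
  by apply: le_lt_trans E; rewrite !exprS expr0; lra.
set N : R := n%:R in x_ge1 *; set x := eps * N in x_ge1 *.
have N_gt0 : 0 < N by move: x_ge1; rewrite /x; nra.
have xN : 100 * (100 * (100 * x)) <= N.
  have -> : 100 * (100 * (100 * x)) = 100 * (100 * (100 * eps)) * N.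
    by rewrite /x; ring.
  by rewrite -[leRHS]mul1r ler_pM2r // ltW.
pose s := Num.trunc (100 * x).
have /andP[s_le s_gt] : s%:R <= 100 * x < s.+1%:R by apply: trunc_itv; lra.
have s_gt0 : (0 < s)%N by rewrite truncn_gt0; lra.
have S_le : s.+1%:R <= 101 * x by rewrite -natr1; lra.
pose K := (n %/ (3 * s.+1))%N.
have K_le : (3 * (K * s.+1) <= n)%N by rewrite mulnCA; exact: leq_trunc_div.
have K_gt : (n < 3 * (K * s.+1) + 3 * s.+1)%N.
  rewrite {1}(divn_eq n (3 * s.+1)) -/K mulnCA ltn_add2l; exact: ltn_pmod.
set S : R := s.+1%:R in s_gt S_le.
pose M : R := (K * s.+1)%:R.
have M_le : 3 * M <= N by rewrite /M /N -natrM ler_nat.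
have M_gt : N < 3 * M + 3 * S.
  by rewrite /M /N /S -!natrM -natrD ltr_nat.
(* Rounding costs less than S, and S is at most 101 x, a tiny fraction of N. *)
have M_ge : 33 * N <= 100 * M by lra.
have K_gt0 : (0 < K)%N.
  by case: (posnP K) => // K0; move: M_ge; rewrite /M K0 mul0n; lra.
exists K.-1, s; rewrite prednK //; split => //.
  have -> : eps * N ^+ 2 = N * x by rewrite /x; ring.
  have MS : (33 * N) * (100 * x) <= (100 * M) * S.
    by apply: ler_pM => //; lra.
  have Nx : 0 <= N * x by apply: mulr_ge0; lra.
  by rewrite natrM -/M -/S; lra.
have [u uE u_ge0] : exists2 u : R, u = 10 ^- 5 & 0 <= u.
  by exists (10 ^- 5); rewrite // invr_ge0 exprn_ge0.
have u1 : 100 * (100 * (10 * u)) = 1.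
  have E : 10 ^+ 5 * u = 1 by rewrite uE mulfV // expf_neq0.
  by rewrite -[RHS]E !exprS expr0; lra.
(* Multiplied by S, the goal is 6 (M + 8 q) S < M^2. Here M^2 is at least 0.1089 N^2, 48 q S at most
   0.0485 N^2, and 6 M S is negligible. *)
rewrite -uE => q q_le; rewrite -(@ltn_pmul2r s.+1) //.
rewrite -[ltnRHS]mulnA mulnACA.
suff : 6 * (M + 8 * q%:R) * S < M * M.
  by rewrite /M /S -!natrM -natrD -!natrM ltr_nat.
have qS : q%:R * S <= 101 * u * N ^+ 2.
  have -> : 101 * u * N ^+ 2 = u * (N / eps) * (101 * x).
    by rewrite /x; field; rewrite gt_eqF.
  apply: ler_pM => //.
have MM : (33 * N) * (33 * N) <= (100 * M) * (100 * M) by apply: ler_pM => //; lra.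
have MS : M * S <= (N / 3) * (101 * x) by apply: ler_pM => //; lra.
have xNN : N * (100 * (100 * (100 * x))) <= N * N by rewrite ler_pM2l.
have NN : 0 < N * N by apply: mulr_gt0.
have uNN : 100 * (100 * (10 * (u * (N * N)))) = N * N.
  by transitivity (100 * (100 * (10 * u)) * (N * N)); [ring|rewrite u1 mul1r].
move: qS; rewrite expr2 -[101 * u * _]mulrA.
by lra.
Qed.

Local Open Scope classical_set_scope.

(** The little-o bound with constant 1 gives [ln n <= eps n * n], and [ln n] is at least 1 once [n]
    is at least e. *)
Lemma near_eps_large (R : realType) (eps : nat -> R) :
    (forall n, 0 < eps n) ->
    (fun n : nat => ln (n%:R : R) / n%:R) =o_\oo eps ->
  \forall n \near \oo, 1 <= eps n * n%:R.
Proof.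
move=> eps_gt0 /eqoP/(_ 1 ltr01) small.
near=> n.
have n_large : expR 1 <= n%:R :> R.
  near: n; exact: nbhs_infty_ger.
have n_gt0 : 0 < n%:R :> R := lt_le_trans (expR_gt0 _) n_large.
have ln_ge1 : 1 <= ln (n%:R : R) by rewrite -[leLHS]expRK ler_ln ?posrE ?expR_gt0.
have : `|ln (n%:R : R) / n%:R| <= 1 * `|eps n| by near: n.
have ln_ge0 : 0 <= ln (n%:R : R) by exact: le_trans ln_ge1.
rewrite mul1r (gtr0_norm (eps_gt0 n)) ger0_norm ?divr_ge0 //.
by rewrite ler_pdivrMr // => /(le_trans ln_ge1).
Unshelve. all: by end_near. Qed.


Theorem theorem5p1 (R : realType) :
  exists2 c : R, 0 < c &
  forall eps : nat -> R,
    (forall n : nat, 0 < eps n < 10 ^- 6) ->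
    (fun n : nat => ln (n%:R : R) / n%:R) =o_\oo eps ->
  \forall n \near \oo,
    forall (d : measure_display) (Omega : measurableType d)
      (P : probability Omega R) (A : ralg n Omega),
    (forall G : graph n,
       ((3^-1)%:E <= success_probability P A (eps n) G)%E) ->
    ((c * (n%:R / eps n))%:E <= query_complexity R A)%E.
Proof.
exists (10 ^- 5); first by rewrite invr_gt0 exprn_gt0.
move=> eps eps_bounds eps_small.
have eps_gt0 n : 0 < eps n by case/andP: (eps_bounds n).
near=> n => d Omega P A success.
have x_ge1 : 1 <= eps n * n%:R by near: n; exact: near_eps_large.
have [k [s [s_gt0 le_n small_eps small_q]]] :=
  hard_parameters (eps_bounds n) x_ge1.
rewrite leNgt; apply/negP => fast.
set B := 10 ^- 5 * (n%:R / eps n) in fast.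
have B_ge0 : 0 <= B by rewrite mulr_ge0 // ?divr_ge0 // ?invr_ge0 ?exprn_ge0 // ltW.
(* The supremum lies below [B], so every execution obeys one integer bound, the floor of [B]. *)
have qmax (G : graph n) (o : ordering G) w : (queries o (A w) <= Num.trunc B)%N.
  rewrite truncn_ge_nat // -lee_fin; apply: le_trans (ltW fast).
  by apply: ereal_sup_ubound; exists G, o, w.
have /andP[B_ge _] := trunc_itv B_ge0.
have [G] := few_queries_failure P s_gt0 le_n small_eps (small_q _ B_ge) qmax.
by rewrite ltNge success.
Unshelve. all: by end_near. Qed.
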